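(* Let $n, m \ge 4$, $N = 2^{n-1}$, $M = 2^{m-1}$, $\alpha = 2^{n-2}-1$, $\beta = 2^{m-2}-1$, and let $n_1 = 2^\nu \mid N$, $m_1 = 2^\mu \mid M$. For $(r,a,s,b,t,c) \in \mathbb{Z}_N\times\mathbb{Z}_M\times\mathbb{Z}_N\times\mathbb{Z}_M\times\mathbb{Z}_N\times\mathbb{Z}_M$ consider $$G = \langle x,y,z,w \mid x^N = y^2 = z^M = w^2 = 1,\ [x,z] = 1,\ x^y = x^\alpha,\ z^w = z^\beta,\ [z,y] = x^r z^a,\ [x,w] = x^s z^b,\ [y,w] = x^t z^c\rangle,$$ with $H = \langle x,y\rangle$, $K = \langle z,w\rangle$. Then $G$ is an exact product $G = HK$ with $H = \langle x\rangle\rtimes\langle y\rangle \cong \mathrm{SD}_{2^n}$, $K = \langle z\rangle\rtimes\langle w\rangle \cong \mathrm{SD}_{2^m}$, $H \cap K = \{1\}$, and with cores $\langle x\rangle^G = \langle x^{n_1}\rangle$ and $\langle z\rangle^G = \langle z^{m_1}\rangle$, if and only if: (i) the following twelve congruences hold: \begin{align*} & r(\alpha+1+a) \equiv 0 \pmod N, && (1+a)^2 \equiv 1 \pmod M,\\ & (1+s)^2 \equiv 1 \pmod N, && b(1+s+\beta) \equiv 0 \pmod M,\\ & r(\beta - 1 - s) \equiv 0 \pmod N, && br \equiv 0 \pmod M,\\ & b(\alpha - 1 - a) \equiv 0 \pmod M, && rb \equiv 0 \pmod N,\\ & t(2+s) \equiv 0 \pmod N, && c(1+\beta) + tb \equiv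 0 \pmod M,\\ & t(1+\alpha) + cr \equiv 0 \pmod N, && c(2+a) \equiv 0 \pmod M; \end{align*} (ii) the additive order of $r$ in $\mathbb{Z}_N$ equals $m_1$; (iii) the additive order of $b$ in $\mathbb{Z}_M$ equals $n_1$.
   Context: Conventions: $[g,h] = g^{-1}h^{-1}gh$, $g^h = h^{-1}gh$. For $n \ge 4$, $\mathrm{SD}_{2^n} = \langle x,y\mid x^{2^{n-1}} = y^2 = 1, x^y = x^\alpha\rangle$ with $\alpha = 2^{n-2}-1$ (semidihedral group of order $2^n$); similarly for $\mathrm{SD}_{2^m}$ with generators $z,w$ and $\beta = 2^{m-2}-1$. The core $X^G$ of a subgroup $X \le G$ is the largest normal subgroup of $G$ contained in $X$ (the intersection of all conjugates of $X$). An exact product $G = HK$ means $G = HK$ with $H\cap K = \{1\}$. *)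

(* Defs.v *)
From mathcomp Require Import all_boot all_fingroup all_solvable.
Set Implicit Arguments. Unset Strict Implicit. Unset Printing Implicit Defensive.
Import GroupScope.

(* N = 2^(n-1) (order of the cyclic part of SD_{2^n}), alpha = 2^(n-2) - 1 *)
Definition Nof (n : nat) : nat := 2 ^ (n - 1).
Definition alphaof (n : nat) : nat := 2 ^ (n - 2) - 1.

Definition addorder (k d : nat) : nat := d %/ gcdn k d.

(* The defining relations of the paper's presentation, evaluated at
   elements x y z w of a finite group.  Conventions: [~ g, h] = g^-1 h^-1 g h
   and g ^ h = h^-1 g h, as in the paper. *)
Definition rels (n m r a s b t c : nat) (rT : finGroupType) (x y z w : rT) : Prop :=
  [/\ x ^+ Nof n = 1, y ^+ 2 = 1, z ^+ Nof m = 1, w ^+ 2 = 1 & [~ x, z] = 1] /\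
  [/\ x ^ y = x ^+ alphaof n, z ^ w = z ^+ alphaof m,
      [~ z, y] = x ^+ r * z ^+ a, [~ x, w] = x ^+ s * z ^+ b
    & [~ y, w] = x ^+ t * z ^+ c].

(* G, with the distinguished elements x y z w, is the group presented by
   generators x y z w and the relations above: the relations hold, x y z w
   generate G, and G has the universal property (every assignment of the
   generators in a finite group satisfying the relations extends to a
   morphism on G).  The presented group is finite (<x,z> is an abelian
   normal subgroup of index <= 4), so this determines G up to an
   isomorphism fixing the generators. *)
Definition presented_by (n m r a s b t c : nat) (gT : finGroupType)
    (G : {group gT}) (x y z w : gT) : Prop :=
  [/\ rels n m r a s b t c x y z w,
      G :=: <<[set x; y; z; w]>> &
      forall (rT : finGroupType) (x' y' z' w' : rT),
        rels n m r a s b t c x' y' z' w' ->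
        exists f : {morphism G >-> rT},
          [/\ f x = x', f y = y', f z = z' & f w = w']].

(* Main.v *)
Require Import Defs.
From mathcomp Require Import all_boot all_fingroup all_solvable.
From mathcomp Require Import ssralg zmodp zify.
Set Implicit Arguments. Unset Strict Implicit. Unset Printing Implicit Defensive.
Import GRing.Theory GroupScope.

(* In additive notation [y] and [w] act on the abelian group [<x, z>] by matrices
   [Y] and [W], and [[y, w] = T] with [T = x ^ t * z ^ c].  The twelve congruences say that
   [Y ^ 2 = W ^ 2 = 1], [Y W = W Y] and [Y T = W T = - T].  They are necessary
   as soon as [<x, z>] is the full group [Z_N * Z_M], which the orders of the
   semidihedral factors force.  Conversely they make the relations hold for
   explicit permutations of [Z_N * Z_M * 2 * 2], in which the four exponents of a
   normal form can be read off.  The subgroup [<x ^ d>] is normalised by [w]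
   exactly when [M] divides [b d], so the core of [<x>] is governed by the
   additive order of [b], and symmetrically for [z], [y] and [r]. *)

(** * Arithmetic in ['Z_N * 'Z_M] through natural representatives *)

Definition Zp_pair (N M i j : nat) : 'Z_N * 'Z_M := (i%:R, j%:R)%R.

Lemma eq_Zp_nat N i j : 1 < N -> (i%:R = j%:R :> 'Z_N)%R <-> i = j %[mod N].
Proof.
move=> N1; split=> [/(congr1 val) | ij]; first by rewrite /= !val_Zp_nat.
by apply: val_inj; rewrite /= !val_Zp_nat.
Qed.

Lemma eq_Zp_pairP N M i j i' j' : 1 < N -> 1 < M ->
  Zp_pair N M i j = Zp_pair N M i' j' <-> i = i' %[mod N] /\ j = j' %[mod M].
Proof.
move=> N1 M1; split=> [E | [/eq_Zp_nat Ei /eq_Zp_nat Ej]].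
  split; first by apply/(eq_Zp_nat i i' N1); exact: (congr1 fst E).
  by apply/(eq_Zp_nat j j' M1); exact: (congr1 snd E).
by congr pair; [apply: Ei | apply: Ej].
Qed.

Lemma Zp_pair_val N M (u : 'Z_N * 'Z_M) : u = Zp_pair N M u.1 u.2.
Proof. by case: u => i j; rewrite /Zp_pair !natr_Zp. Qed.

Lemma Zp_pairD N M i j i' j' :
  (Zp_pair N M i j + Zp_pair N M i' j')%R = Zp_pair N M (i + i') (j + j').
Proof. by rewrite /Zp_pair !natrD. Qed.

Lemma Zp_pairX N M i j k : (Zp_pair N M i j *+ k)%R = Zp_pair N M (i * k) (j * k).
Proof.
elim: k => [|k IH]; first by rewrite !muln0 mulr0n.
by rewrite mulrSr IH Zp_pairD !mulnS !(addnC _ (_ * k)%N).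
Qed.

(** The 2 by 2 matrix with rows [(p, q)] and [(p', q')], acting on canonical representatives. The
    entry [q] leads from ['Z_M] to ['Z_N] and [p'] the other way, so additivity depends on
    divisibility conditions. *)
Definition Zp_pair_map (N M p q p' q' : nat) (u : 'Z_N * 'Z_M) : 'Z_N * 'Z_M :=
  Zp_pair N M (p * u.1 + q * u.2) (p' * u.1 + q' * u.2).

Section ZpPairMap.
Variables (N M p q p' q' : nat).
Hypotheses (N1 : 1 < N) (M1 : 1 < M).
Hypotheses (qM : N %| q * M) (p'N : M %| p' * N).
Let f := @Zp_pair_map N M p q p' q'.

(** Changing [j] by [M] moves the first coordinate by [q * M], and changing [i] by [N] moves the
    second by [p' * N]; [qM] and [p'N] make both shifts vanish. *)
Lemma Zp_pair_mapE i j :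
  f (Zp_pair N M i j) = Zp_pair N M (p * i + q * j) (p' * i + q' * j).
Proof.
have mod_mul A B e k : A %| e * B -> e * (k %% B) = e * k %[mod A].
  move=> dvd; rewrite [in RHS](divn_eq k B) mulnDr mulnCA.
  by rewrite -modnDml (eqP (dvdn_mull _ dvd)) add0n.
apply/eq_Zp_pairP => //; rewrite /= !val_Zp_nat //.
split; rewrite -modnDm.
  by rewrite (mod_mul N N) ?dvdn_mull // (mod_mul N M) // modnDm.
by rewrite (mod_mul M N) // (mod_mul M M) ?dvdn_mull // modnDm.
Qed.

Lemma Zp_pair_mapD : {morph f : u v / (u + v)%R}.
Proof.
move=> u v; rewrite (Zp_pair_val u) (Zp_pair_val v) Zp_pairD !Zp_pair_mapE Zp_pairD.
by congr Zp_pair; lia.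
Qed.
End ZpPairMap.

(** * Additive maps of ['Z_N * 'Z_M] and the permutation model built from them *)

Lemma morph_mulrn (U V : zmodType) (f : U -> V) u i :
  {morph f : u v / (u + v)%R} -> f (u *+ i)%R = (f u *+ i)%R.
Proof.
move=> fD; elim: i => [|i IH]; last by rewrite !mulrSr fD IH.
by rewrite !mulr0n; apply: (addrI (f 0%R)); rewrite -fD !addr0.
Qed.

(** Reduces an identity between matrices to its two columns, hence to congruences between
    entries. *)
Lemma eq_Zp_pair_morph (N M : nat) (U : zmodType) (f g : 'Z_N * 'Z_M -> U) :
  {morph f : u v / (u + v)%R} -> {morph g : u v / (u + v)%R} ->
  f (Zp_pair N M 1 0) = g (Zp_pair N M 1 0) ->
  f (Zp_pair N M 0 1) = g (Zp_pair N M 0 1) ->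
  f =1 g.
Proof.
move=> fD gD f1 f2 u.
have gen : u = (Zp_pair N M 1 0 *+ u.1 + Zp_pair N M 0 1 *+ u.2)%R.
  by rewrite !Zp_pairX Zp_pairD !mul0n !mul1n addn0; apply: Zp_pair_val.
rewrite [in LHS]gen [in RHS]gen.
by rewrite fD gD !(morph_mulrn _ _ fD) !(morph_mulrn _ _ gD) f1 f2.
Qed.

(* The triple [(u, k, l)] stands for the word [w ^+ l * y ^+ k * u], on which the
   generators act by right multiplication, with [y ^ w = y * T]. *)
Definition shift_fun (N M : nat) (v : 'Z_N * 'Z_M)
    (u : 'Z_N * 'Z_M * bool * bool) :=
  ((u.1.1 + v)%R, u.1.2, u.2).

Definition twist_y (N M : nat) (Y : 'Z_N * 'Z_M -> 'Z_N * 'Z_M)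
    (u : 'Z_N * 'Z_M * bool * bool) :=
  (Y u.1.1, ~~ u.1.2, u.2).

Definition twist_w (N M : nat) (W : 'Z_N * 'Z_M -> 'Z_N * 'Z_M) T
    (u : 'Z_N * 'Z_M * bool * bool) :=
  ((W u.1.1 + T *+ u.1.2)%R, u.1.2, ~~ u.2).

Lemma shift_inj (N M : nat) (v : 'Z_N * 'Z_M) : injective (shift_fun v).
Proof.
apply: (can_inj (g := shift_fun (- v)%R)) => -[[u k] l].
by rewrite /shift_fun /= addrK.
Qed.

Lemma twist_yK (N M : nat) (Y : 'Z_N * 'Z_M -> _) :
  involutive Y -> involutive (twist_y Y).
Proof. by move=> YK [[u k] l]; rewrite /twist_y /= YK negbK. Qed.

Lemma twist_wK (N M : nat) (W : 'Z_N * 'Z_M -> _) (T : 'Z_N * 'Z_M) :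
  {morph W : u v / (u + v)%R} -> involutive W -> W T = (- T)%R ->
  involutive (twist_w W T).
Proof.
move=> WD WK WT [[u k] l]; rewrite /twist_w /= WD WK negbK (morph_mulrn _ _ WD) WT.
by rewrite -addrA -mulrnDl addNr mul0rn addr0.
Qed.

(** The relations are checked pointwise on triples. For the final clause both sides are evaluated at
    the base point [(0, false, false)]: the left one gives [(u, odd k, false)] and the right one
    [(v, false, odd l)]. *)
Lemma affine_perms (N M : nat) (Y W : 'Z_N * 'Z_M -> 'Z_N * 'Z_M) (T : 'Z_N * 'Z_M) :
  {morph Y : u v / (u + v)%R} -> {morph W : u v / (u + v)%R} ->
  involutive Y -> involutive W -> (forall u, Y (W u) = W (Y u)) ->
  Y T = (- T)%R -> W T = (- T)%R ->
  exists (rT : finGroupType) (tr : 'Z_N * 'Z_M -> rT) (y w : rT),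
  [/\ {morph tr : u v / (u + v)%R >-> u * v}, y ^+ 2 = 1, w ^+ 2 = 1,
     forall u, tr u ^ y = tr (Y u) & forall u, tr u ^ w = tr (W u)] /\
   [~ y, w] = tr T /\
  forall k l u v, y ^+ k * tr u = w ^+ l * tr v -> [/\ u = v, ~~ odd k & ~~ odd l].
Proof.
move=> YD WD YK WK YW YT WT.
have yI := can_inj (twist_yK YK); have wI := can_inj (twist_wK WD WK WT).
exists {perm 'Z_N * 'Z_M * bool * bool}, (fun v => perm (@shift_inj N M v)),
  (perm yI), (perm wI).
have y2 : perm yI ^+ 2 = 1 by apply/permP=> u; rewrite permM !permE twist_yK.
have w2 : perm wI ^+ 2 = 1 by apply/permP=> u; rewrite permM !permE twist_wK.
split; first split=> //.
- by move=> u v; apply/permP=> [[[e k] l]]; rewrite permM !permE /shift_fun /= addrA.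
- move=> u; rewrite conjgE; apply: canLR (mulKg _) _.
  by apply/permP=> [[[e k] l]]; rewrite !permM !permE /shift_fun /twist_y /= YD.
- move=> u; rewrite conjgE; apply: canLR (mulKg _) _.
  apply/permP=> [[[e k] l]]; rewrite !permM !permE /shift_fun /twist_w /=.
  by rewrite WD addrAC.
split.
  rewrite commgEl conjgE; do 2!apply: canLR (mulKg _) _.
  apply/permP=> [[[e k] l]]; rewrite !permM !permE /shift_fun /twist_w /twist_y /=.
  rewrite YD YW (morph_mulrn _ _ YD) YT; congr (_, _, _).
  by rewrite -addrA; congr (_ + _)%R; case: k; rewrite /= ?addNr ?add0r.
move=> k l u v /(congr1 (fun p : {perm 'Z_N * 'Z_M * bool * bool} =>
  p ((0%R : 'Z_N * 'Z_M), false, false))).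
have Y0 := @morph_mulrn _ _ Y 0%R 0 YD; rewrite !mulr0n in Y0.
have W0 := @morph_mulrn _ _ W 0%R 0 WD; rewrite !mulr0n in W0.
have yk : (perm yI ^+ k) (0%R, false, false) = (0%R, odd k, false).
  elim: k => [|k IH]; first by rewrite expg0 perm1.
  by rewrite expgSr permM IH permE /twist_y /= Y0.
have wl : (perm wI ^+ l) (0%R, false, false) = (0%R, false, odd l).
  elim: l => [|l IH]; first by rewrite expg0 perm1.
  by rewrite expgSr permM IH permE /twist_w /= W0 add0r.
by rewrite !permM yk wl !permE /shift_fun /= !add0r => -[-> -> <-].
Qed.

(** Differences are replaced by equalities of two sides, as subtraction on [nat] truncates. In
    order: two entries of [Y ^ 2 = 1], two of [W ^ 2 = 1], the four of [Y W = W Y], then [W T = - T]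
    and [Y T = - T]. *)
Definition compat (N M al be r a s b t c : nat) : Prop :=
   [/\ [/\ r * (al + 1 + a) = 0 %[mod N], (1 + a) ^ 2 = 1 %[mod M],
           (1 + s) ^ 2 = 1 %[mod N], b * (1 + s + be) = 0 %[mod M]
         & r * be = r * (1 + s) %[mod N]],
       [/\ b * r = 0 %[mod M],
           b * al = b * (1 + a) %[mod M],
           r * b = 0 %[mod N], t * (2 + s) = 0 %[mod N]
         & c * (1 + be) + t * b = 0 %[mod M]]
     & t * (1 + al) + c * r = 0 %[mod N] /\ c * (2 + a) = 0 %[mod M]].

Lemma Nof_gt1 n : 1 < n -> 1 < Nof n.
Proof. by move=> n1; apply: leq_ltn_trans (ltn_expl _ _) => //; lia. Qed.

(** With [J = 2 ^ (n - 3)] one has [alpha = 2 J - 1] and [N = 4 J], so [alpha ^ 2 = (J - 1) N + 1].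
    This settles the diagonal entries of [Y ^ 2] and [W ^ 2] that the twelve congruences leave
    out. *)
Lemma alphaof_sqr n : 3 < n -> alphaof n * alphaof n = 1 %[mod Nof n].
Proof.
case: n => [|[|[|[|k]]]] // _; rewrite /alphaof /Nof !subSS !subn0 !expnS.
set J := (2 * 2 ^ k)%N; have J0 : 0 < J by rewrite muln_gt0 expn_gt0.
rewrite (_ : (_ * _)%N = ((J - 1) * (2 * (2 * J)) + 1)%N); last by nia.
by rewrite modnMDl.
Qed.

(** Here [x] and [z] are the translations by the two basis vectors. The two divisibility hypotheses
    make [Y] and [W] well defined, and the congruences supply the hypotheses of [affine_perms]. *)
Lemma rels_model n m r a s b t c (N := Nof n) (M := Nof m) :
  3 < n -> 3 < m -> N %| r * M -> M %| b * N ->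
  compat N M (alphaof n) (alphaof m) r a s b t c ->
  exists (rT : finGroupType) (x y z w : rT), rels n m r a s b t c x y z w /\
  forall i j k l, y ^+ k * x ^+ i = w ^+ l * z ^+ j ->
    [/\ N %| i, M %| j, ~~ odd k & ~~ odd l].
Proof.
move=> n3 m3 rM bN [[e1 e2 e3 e4 e5] [e6 e7 e8 e9 e10] [e11 e12]].
have N1 : 1 < N by apply: Nof_gt1; lia.
have M1 : 1 < M by apply: Nof_gt1; lia.
have al2 := alphaof_sqr n3; have be2 := alphaof_sqr m3.
rewrite -/N -/M in al2 be2.
set al := alphaof n in e1 e7 e11 al2; set be := alphaof m in e4 e5 e10 be2.
pose Y := @Zp_pair_map N M al r 0 (1 + a).
pose W := @Zp_pair_map N M (1 + s) 0 b be.
pose T := Zp_pair N M t c.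
have YE i j :
    Y (Zp_pair N M i j) = Zp_pair N M (al * i + r * j) (0 * i + (1 + a) * j).
  exact: Zp_pair_mapE.
have WE i j :
    W (Zp_pair N M i j) = Zp_pair N M ((1 + s) * i + 0 * j) (b * i + be * j).
  exact: Zp_pair_mapE.
have YD : {morph Y : u v / (u + v)%R} by apply: Zp_pair_mapD.
have WD : {morph W : u v / (u + v)%R} by apply: Zp_pair_mapD.
clearbody Y W.
have YK : involutive Y.
  apply: eq_Zp_pair_morph => // [u v||]; first by rewrite !YD.
    rewrite !YE; apply/eq_Zp_pairP => //; split; last by congr (_ %% _); lia.
    by rewrite -[RHS]al2; congr (_ %% _); lia.
  rewrite !YE; apply/eq_Zp_pairP => //; split.
    by rewrite -[RHS]e1; congr (_ %% _); lia.
  by rewrite -[RHS]e2; congr (_ %% _); lia.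
have WK : involutive W.
  apply: eq_Zp_pair_morph => // [u v||]; first by rewrite !WD.
    rewrite !WE; apply/eq_Zp_pairP => //; split.
      by rewrite -[RHS]e3; congr (_ %% _); lia.
    by rewrite -[RHS]e4; congr (_ %% _); lia.
  rewrite !WE; apply/eq_Zp_pairP => //; split; first by congr (_ %% _); lia.
  by rewrite -[RHS]be2; congr (_ %% _); lia.
have YW u : Y (W u) = W (Y u).
  move: u; apply: eq_Zp_pair_morph => // [u v|u v||]; cbv beta.
  - by rewrite WD YD.
  - by rewrite YD WD.
  - rewrite !WE !YE !WE; apply/eq_Zp_pairP => //; split.
      (* The off-diagonal product [r * b] vanishes modulo [N], which leaves the same diagonal
         product on both sides. *)
      transitivity ((al * (1 + s) + r * b) %% N)%N.
        by congr (_ %% _); lia.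
      by rewrite -modnDmr e8 mod0n addn0; congr (_ %% _); lia.
    transitivity ((b * (1 + a)) %% M)%N;
    first by congr (_ %% _); lia.
    by rewrite -e7; congr (_ %% _); lia.
  - rewrite !WE !YE !WE; apply/eq_Zp_pairP => //; split.
      transitivity ((r * be) %% N)%N;
    first by congr (_ %% _); lia.
      by rewrite e5; congr (_ %% _); lia.
    transitivity ((b * r + be * (1 + a)) %% M)%N; last by congr (_ %% _); lia.
    by rewrite -[in RHS]modnDml e6 mod0n; congr (_ %% _); lia.
have YT : Y T = (- T)%R.
  apply/eqP; rewrite -addr_eq0 YE Zp_pairD.
  apply/eqP/(eq_Zp_pairP _ _ 0 0) => //; split.
    by rewrite -[RHS]e11; congr (_ %% _); lia.
  by rewrite -[RHS]e12; congr (_ %% _); lia.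
have WT : W T = (- T)%R.
  apply/eqP; rewrite -addr_eq0 WE Zp_pairD.
  apply/eqP/(eq_Zp_pairP _ _ 0 0) => //; split.
    by rewrite -[RHS]e9; congr (_ %% _); lia.
  by rewrite -[RHS]e10; congr (_ %% _); lia.
have [rT [tr [y [w [[trD y2 w2 trY trW] [yw inj]]]]]] :=
  affine_perms YD WD YK WK YW YT WT.
have trX u i : tr u ^+ i = tr (u *+ i)%R.
  elim: i => [|i IH]; last by rewrite expgSr IH mulrSr trD.
  by rewrite mulr0n; apply: (mulgI (tr 0%R)); rewrite -trD mulg1 addr0.
have trE i j :
    tr (Zp_pair N M i j) = tr (Zp_pair N M 1 0) ^+ i * tr (Zp_pair N M 0 1) ^+ j.
  by rewrite !trX -trD !Zp_pairX Zp_pairD !mul0n !mul1n addn0.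
have tr1 : tr (Zp_pair N M 0 0) = 1.
  by rewrite trE !expg0 mulg1.
exists rT, (tr (Zp_pair N M 1 0)), y, (tr (Zp_pair N M 0 1)), w.
split; first split; first split=> //.
- rewrite trX Zp_pairX mul1n mul0n -tr1.
  by congr tr; apply/eq_Zp_pairP; rewrite ?modnn ?mod0n.
- rewrite trX Zp_pairX mul1n mul0n -tr1.
  by congr tr; apply/eq_Zp_pairP; rewrite ?modnn ?mod0n.
- by apply/eqP/commgP; rewrite /commute -!trD addrC.
- split.
  + by rewrite trY YE trX Zp_pairX !(muln0, muln1, mul0n, mul1n, addn0).
  + by rewrite trW WE trX Zp_pairX !(muln0, muln1, mul0n, mul1n, addn0).
  + rewrite commgEl trY YE; apply: canLR (mulKg _) _.
    by rewrite -trE -trD Zp_pairD !(muln0, muln1, mul0n, add0n).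
  + rewrite commgEl trW WE; apply: canLR (mulKg _) _.
    by rewrite -trE -trD Zp_pairD !(muln0, muln1, mul0n, addn0).
  + by rewrite yw -trE.
move=> i j k l; rewrite !trX => /inj [eq_ij -> ->].
move: eq_ij; rewrite !Zp_pairX !mul0n !mul1n => /eq_Zp_pairP[] // ei ej.
by split=> //; rewrite /dvdn ?ei -?ej mod0n.
Qed.

(** * Additive orders, cores of cyclic subgroups, recognition of semidihedral groups *)

(** After division by [gcdn k d] the two factors are coprime, and Gauss's lemma applies. *)
Lemma addorder_dvdn k d i : 0 < d -> (d %| k * i) = (addorder k d %| i).
Proof.
move=> d0; have g0 : 0 < gcdn k d by rewrite gcdn_gt0 d0 orbT.
have kE := divnK (dvdn_gcdl k d); have dE := divnK (dvdn_gcdr k d).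
have cop : coprime (d %/ gcdn k d) (k %/ gcdn k d).
  by rewrite /coprime -(eqn_pmul2r g0) muln_gcdl dE kE mul1n gcdnC.
transitivity (d %/ gcdn k d * gcdn k d %| k %/ gcdn k d * gcdn k d * i).
  by rewrite dE kE.
by rewrite mulnAC dvdn_pmul2r // Gauss_dvdr.
Qed.

(** The core is stable under conjugation by [w] and lies in [<[x]>], so an element [x ^+ i] of it
    has [(x ^+ i) ^ w] in [<[x]>], which forces [d %| i]. *)
Lemma gcore_cycle (gT : finGroupType) (G : {group gT}) (x w : gT) d :
  w \in G -> G \subset 'N(<[x ^+ d]>) ->
  (forall i, (x ^+ i) ^ w \in <[x]> -> d %| i) ->
  gcore <[x]> G = <[x ^+ d]>.
Proof.
move=> wG nG dw; apply/eqP; rewrite eqEsubset gcore_max ?cycleX // andbT.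
apply/subsetP=> g gC; have /cycleP[i gE] := subsetP (gcore_sub _ _) _ gC.
have /(subsetP (gcore_sub _ _)) : g ^ w \in gcore <[x]> G.
  by rewrite memJ_norm // (subsetP (gcore_norm _ _)).
by rewrite gE => /dw /dvdnP[k ->]; rewrite mulnC expgM mem_cycle.
Qed.

Lemma norm_gen_conj (gT : finGroupType) (S : {set gT}) g :
  (forall u, u \in S -> u ^ g \in <<S>>) -> g \in 'N(<<S>>).
Proof.
move=> Sg; rewrite inE -genJ gen_subG.
by apply/subsetP=> _ /imsetP[u uS ->]; apply: Sg.
Qed.

(** The relations make [H] an image of the semidihedral group, and the equal orders make that map
    injective. *)
Lemma semidihedral_isog (gT : finGroupType) n (x y : gT)
    (H : {group gT} := <<[set x; y]>>%G) :
  3 < n -> x ^+ Nof n = 1 -> y ^+ 2 = 1 -> x ^ y = x ^+ alphaof n ->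
  #|H| = (2 ^ n)%N -> H \isog 'SD_(2 ^ n).
Proof.
move=> n3 xN y2 xy oH; rewrite isogEcard card_semidihedral // oH leqnn andbT.
rewrite Grp_semidihedral //; apply/existsP; exists (x, y).
have NE : (2 ^ n.-1)%N = Nof n by rewrite /Nof subn1.
have alE : (2 ^ n.-2).-1 = alphaof n by rewrite /alphaof subn2 subn1.
by rewrite /= !xpair_eqE joing_idl joing_idr NE alE xN y2 xy !eqxx.
Qed.

(** * Consequences of the relations in an arbitrary finite group *)

Section Presentation.
Variables (n m r a s b t c : nat) (gT : finGroupType) (x y z w : gT).
Hypothesis rel : rels n m r a s b t c x y z w.
Let N := Nof n.
Let M := Nof m.
Let al := alphaof n.
Let be := alphaof m.

Let xN : x ^+ N = 1. Proof. by case: rel => -[]. Qed.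
Let y2 : y ^+ 2 = 1. Proof. by case: rel => -[]. Qed.
Let zM : z ^+ M = 1. Proof. by case: rel => -[]. Qed.
Let w2 : w ^+ 2 = 1. Proof. by case: rel => -[]. Qed.
Let xz : commute x z.
Proof. by case: rel => -[_ _ _ _ /eqP/commgP]. Qed.

Definition xzpow i j : gT := x ^+ i * z ^+ j.

Lemma xzpowM i j i' j' : xzpow i j * xzpow i' j' = xzpow (i + i') (j + j').
Proof.
have h : commute (x ^+ i') (z ^+ j) by apply: commuteX2.
by rewrite /xzpow !expgD mulgA -(mulgA (x ^+ i)) -h !mulgA.
Qed.

Lemma xzpowC i j i' j' : xzpow i j * xzpow i' j' = xzpow i' j' * xzpow i j.
Proof. by rewrite !xzpowM addnC (addnC j). Qed.

Lemma xzpowX i j k : xzpow i j ^+ k = xzpow (i * k) (j * k).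
Proof.
elim: k => [|k IH]; first by rewrite !muln0 expg0 /xzpow !expg0 mulg1.
by rewrite expgSr IH xzpowM !mulnS ![(_ + _ * k)%N]addnC.
Qed.

Lemma xzpow_conj_y i j : xzpow i j ^ y = xzpow (al * i + r * j) ((1 + a) * j).
Proof.
case: rel => _ [xy _ zy _ _].
have zyE : z ^ y = xzpow r (1 + a).
  rewrite -[z ^ y](mulKVg z) -commgEl zy -/(xzpow r a).
  by rewrite {1}(_ : z = xzpow 0 1) ?xzpowM // /xzpow expg0 mul1g.
have xyE : x ^ y = xzpow al 0 by rewrite xy /xzpow expg0 mulg1.
by rewrite {1}/xzpow conjMg !conjXg zyE xyE !xzpowX xzpowM mul0n.
Qed.

Lemma xzpow_conj_w i j : xzpow i j ^ w = xzpow ((1 + s) * i) (b * i + be * j).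
Proof.
case: rel => _ [_ zw _ xw _].
have xwE : x ^ w = xzpow (1 + s) b.
  rewrite -[x ^ w](mulKVg x) -commgEl xw -/(xzpow s b).
  by rewrite {1}(_ : x = xzpow 1 0) ?xzpowM // /xzpow expg0 mulg1.
have zwE : z ^ w = xzpow 0 be by rewrite zw /xzpow expg0 mul1g.
by rewrite {1}/xzpow conjMg !conjXg zwE xwE !xzpowX xzpowM mul0n addn0.
Qed.

Lemma conj_y_w : y ^ w = y * xzpow t c.
Proof. by case: rel => _ [_ _ _ _ yw]; rewrite -[y ^ w](mulKVg y) -commgEl yw. Qed.

(** * The case where [<x, z>] is the full group [Z_N * Z_M] *)

Section Free.
Hypothesis free : forall i j, xzpow i j = 1 -> N %| i /\ M %| j.
Hypotheses (n3 : 3 < n) (m3 : 3 < m).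

Lemma xzpow_inj i j i' j' :
  xzpow i j = xzpow i' j' -> i = i' %[mod N] /\ j = j' %[mod M].
Proof.
move=> E; have [N1 M1] : 1 < N /\ 1 < M by split; apply: Nof_gt1; lia.
(* Exponents are natural numbers, so the inverse of [x ^+ i'] is written [x ^+ ((N - 1) * i')], and
   similarly for [z]. *)
have lift p d e : 1 < p -> p %| d + (p - 1) * e -> d = e %[mod p].
  move=> p1 /eqP dvd; transitivity (((d + (p - 1) * e) %% p + e) %% p)%N.
    by rewrite modnDml -addnA -mulSnr -subSn ?(ltnW p1) // subn1 addnC mulnC modnMDl.
  by rewrite dvd.
have /free[] : xzpow (i + (N - 1) * i') (j + (M - 1) * j') = 1; last first.
  by split; apply: lift.
rewrite -xzpowM E xzpowM -!mulSn -addn1 !subnK ?(ltnW N1) ?(ltnW M1) //.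
rewrite -addn1 subnK ?(ltnW M1) //.
by rewrite /xzpow !expgM xN zM !expg1n mulg1.
Qed.

(** Identities between conjugates of [x], [z] and [y] are turned into congruences by comparing
    exponents with [xzpow_inj]. *)
Lemma compat_of_free : compat N M al be r a s b t c.
Proof.
have yy1 : y * y = 1 := y2.
have ww1 : w * w = 1 := w2.
have yy g : (g ^ y) ^ y = g by rewrite -conjgM yy1 conjg1.
have ww g : (g ^ w) ^ w = g by rewrite -conjgM ww1 conjg1.
(* Since [y ^ w = y * T] with [T] in the abelian group [<x, z>], the elements [y ^ w] and [y] act on
   it in the same way; hence [Y] and [W] commute. *)
have yw i j : (xzpow i j ^ y) ^ w = (xzpow i j ^ w) ^ y.
  rewrite conjJg conj_y_w conjgM xzpow_conj_w xzpow_conj_y.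
  by rewrite conjgE xzpowC mulKg.
have xz0 : xzpow 0 0 = 1 by rewrite /xzpow mulg1.
(* Expanding [(y ^ w) ^ w = y] gives [W T = - T]; below, expanding [(y ^ w) ^+ 2 = 1] gives
   [Y T = - T]. *)
have T1 : xzpow t c ^ w * xzpow t c = 1.
  have := ww y; rewrite conj_y_w conjMg conj_y_w -mulgA => /(canRL (mulKg _)).
  by rewrite mulVg xzpow_conj_w !xzpowM addnC (addnC c).
have T2 : xzpow t c ^ y * xzpow t c = 1.
  have : (y ^ w) * (y ^ w) = 1 by rewrite -conjMg yy1 conj1g.
  rewrite conj_y_w conjgE -(mulgA y) => <-.
  have -> : y^-1 = y by apply/eqP; rewrite eq_invg_mul yy1.
  by rewrite !mulgA.
have := yy (xzpow 0 1); rewrite !xzpow_conj_y => /xzpow_inj[e1 e2].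
have := ww (xzpow 1 0); rewrite !xzpow_conj_w => /xzpow_inj[e3 e4].
have := yw 1%N 0; rewrite !(xzpow_conj_y, xzpow_conj_w) => /xzpow_inj[e8 e7].
have := yw 0 1%N; rewrite !(xzpow_conj_y, xzpow_conj_w) => /xzpow_inj[e5 e6].
rewrite xzpow_conj_w xzpowM -xz0 in T1; have [e9 e10] := xzpow_inj T1.
rewrite xzpow_conj_y xzpowM -xz0 in T2; have [e11 e12] := xzpow_inj T2.
split; split.
- by rewrite -e1; congr (_ %% _); lia.
- by rewrite -e2; congr (_ %% _); lia.
- by rewrite -e3; congr (_ %% _); lia.
- by rewrite -e4; congr (_ %% _); lia.
- transitivity ((al * ((1 + s) * 0) + r * (b * 0 + be * 1)) %% N)%N;
    first by congr (_ %% _); lia.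
  by rewrite -e5; congr (_ %% _); lia.
(* The matrix entry reads [b * r + be * (1 + a) = (1 + a) * be]; the common term is added to both
   sides so that [e6] applies. *)
- apply/eqP; rewrite -(eqn_modDr (be * (1 + a))); apply/eqP.
  transitivity ((b * (al * 0 + r * 1) + be * ((1 + a) * 1)) %% M)%N;
    first by congr (_ %% _); lia.
  by rewrite e6; congr (_ %% _); lia.
- transitivity ((b * (al * 1 + r * 0) + be * ((1 + a) * 0)) %% M)%N;
    first by congr (_ %% _); lia.
  by rewrite e7; congr (_ %% _); lia.
- apply/eqP; rewrite -(eqn_modDr (al * (1 + s))); apply/eqP.
  transitivity ((al * ((1 + s) * 1) + r * (b * 1 + be * 0)) %% N)%N;
    first by congr (_ %% _); lia.
  by rewrite -e8; congr (_ %% _); lia.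
- by rewrite -e9; congr (_ %% _); lia.
- by rewrite -e10; congr (_ %% _); lia.
- by rewrite -e11; congr (_ %% _); lia.
- by rewrite -e12; congr (_ %% _); lia.
Qed.

(** Conjugating [z ^+ M = 1] by [y] and [x ^+ N = 1] by [w] yields trivial elements with exponents
    [r * M] of [x] and [b * N] of [z]. *)
Lemma dvdn_of_free : N %| r * M /\ M %| b * N.
Proof.
have zy : xzpow 0 M ^ y = 1 by rewrite /xzpow zM mulg1 conj1g.
have xw : xzpow N 0 ^ w = 1 by rewrite /xzpow xN mulg1 conj1g.
rewrite xzpow_conj_y in zy; rewrite xzpow_conj_w in xw.
have [+ _] := free zy; have [_] := free xw.
by rewrite !muln0 addn0 add0n.
Qed.

Variable (G : {group gT}).
Hypothesis genG : G :=: <<[set x; y; z; w]>>.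

Let mem4 : [/\ x \in G, y \in G, z \in G & w \in G].
Proof. by rewrite genG; split; apply: mem_gen; rewrite !inE eqxx ?orbT. Qed.

(** Conjugation by [w] gives [x ^+ i] the [z]-exponent [b * i], so the conjugate lies in [<[x]>]
    only if [M %| b * i]. The other generators normalise every subgroup of [<[x]>]. *)
Lemma gcore_x_of_free : gcore <[x]> G = <[x ^+ addorder b M]>.
Proof.
have M0 : 0 < M by apply: ltnW; apply: Nof_gt1; lia.
set d := addorder b M; have [xG yG zG wG] := mem4.
have xE i : x ^+ i = xzpow i 0 by rewrite /xzpow mulg1.
apply: (gcore_cycle wG) => [|i]; last first.
  case/cycleP=> k; rewrite !xE xzpow_conj_w => /xzpow_inj[_].
  by rewrite muln0 addn0 mod0n => /eqP; rewrite -/(dvdn _ _) addorder_dvdn.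
have bd : M %| b * d by rewrite addorder_dvdn.
rewrite genG gen_subG; apply/subsetP=> g.
have nn u : (x ^+ d) ^ u \in <[x ^+ d]> -> u \in 'N(<[x ^+ d]>).
  by rewrite -norms_cycle cycle_subG.
rewrite !(in_setU, in_set1) -!orbA => /or4P[] /eqP->; apply: nn.
- by rewrite conjgE -(commuteX d (commute_refl x)) mulKg cycle_id.
- by rewrite {1}xE xzpow_conj_y !muln0 addn0 -xE mulnC expgM mem_cycle.
- by rewrite conjgE (commuteX2 d 1 xz) mulKg cycle_id.
- rewrite {1}xE xzpow_conj_w muln0 addn0 /xzpow mulnC !expgM.
  by rewrite -[z ^+ b ^+ d]expgM -(divnK bd) mulnC expgM zM expg1n mulg1 mem_cycle.
Qed.

Lemma gcore_z_of_free : gcore <[z]> G = <[z ^+ addorder r N]>.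
Proof.
have N0 : 0 < N by apply: ltnW; apply: Nof_gt1; lia.
set d := addorder r N; have [xG yG zG wG] := mem4.
have zE i : z ^+ i = xzpow 0 i by rewrite /xzpow mul1g.
apply: (gcore_cycle yG) => [|i]; last first.
  case/cycleP=> k; rewrite !zE xzpow_conj_y => /xzpow_inj[+ _].
  by rewrite muln0 add0n mod0n => /eqP; rewrite -/(dvdn _ _) addorder_dvdn.
have rd : N %| r * d by rewrite addorder_dvdn.
rewrite genG gen_subG; apply/subsetP=> g.
have nn u : (z ^+ d) ^ u \in <[z ^+ d]> -> u \in 'N(<[z ^+ d]>).
  by rewrite -norms_cycle cycle_subG.
rewrite !(in_setU, in_set1) -!orbA => /or4P[] /eqP->; apply: nn.
- by rewrite conjgE -(commuteX2 1 d xz) mulKg cycle_id.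
- rewrite {1}zE xzpow_conj_y muln0 add0n /xzpow -(divnK rd) mulnC.
  rewrite expgM xN expg1n mul1g.
  by rewrite mulnC expgM mem_cycle.
- by rewrite conjgE -(commuteX d (commute_refl z)) mulKg cycle_id.
- by rewrite {1}zE xzpow_conj_w !muln0 add0n -zE mulnC expgM mem_cycle.
Qed.
End Free.

(** With [A = <x, z>], the element [y] normalises [A] and [w] normalises [B = A <y>], so
    [G = A <y> <w>]. *)
Lemma mulg_of_rels (G : {group gT}) : G :=: <<[set x; y; z; w]>> ->
  <<[set x; y]>> * <<[set z; w]>> = G.
Proof.
move=> genG; have xE : x = xzpow 1 0 by rewrite /xzpow mulg1.
have zE : z = xzpow 0 1 by rewrite /xzpow mul1g.
pose A := <<[set x; z]>>%G.
have xA : x \in A by rewrite mem_gen // !inE eqxx.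
have zA : z \in A by rewrite mem_gen // !inE eqxx orbT.
have xzpowA i j : xzpow i j \in A by rewrite groupM ?groupX.
have AE : A = <[x]> * <[z]> :> {set gT}.
  rewrite -cent_joinEr ?cycle_subG ?joing_idl ?joing_idr //.
  by rewrite /= cent_cycle; apply/cent1P.
have nAy : <[y]> \subset 'N(A).
  rewrite cycle_subG; apply: norm_gen_conj => u.
  by rewrite !inE => /orP[] /eqP->; [rewrite {1}xE | rewrite {1}zE];
     rewrite xzpow_conj_y xzpowA.
pose B := (A <*> <[y]>)%G.
have sAB : A \subset B by apply: joing_subl.
have yB : y \in B by rewrite -cycle_subG joing_subr.
have nBw : <[w]> \subset 'N(B).
  rewrite cycle_subG [B : {set _}](_ : _ = <<[set x; z; y]>>); last first.
    by rewrite /= joing_idl joing_idr.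
  apply: norm_gen_conj => u.
  have <- : B = <<[set x; z; y]>> :> {set _} by rewrite /= joing_idl joing_idr.
  rewrite !inE -orbA => /or3P[] /eqP->.
  - by rewrite {1}xE xzpow_conj_w (subsetP sAB).
  - by rewrite {1}zE xzpow_conj_w (subsetP sAB).
  - by rewrite conj_y_w groupM // (subsetP sAB).
(* Moving [<[y]>] to the left of [A = <[x]> * <[z]>] regroups the product as [(<[y]> <[x]>) (<[z]>
   <[w]>)]. *)
have HKE : A * <[y]> * <[w]> \subset <<[set x; y]>> * <<[set z; w]>>.
  rewrite -(normC nAy) AE mulgA -(mulgA (_ * _)); apply: mulgSS; apply: mul_subG.
  - by rewrite cycle_subG mem_gen // !inE eqxx orbT.
  - by rewrite cycle_subG mem_gen // !inE eqxx.
  - by rewrite cycle_subG mem_gen // !inE eqxx.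
  - by rewrite cycle_subG mem_gen // !inE eqxx orbT.
apply/eqP; rewrite eqEsubset; apply/andP; split.
  by rewrite mul_subG // genG genS //; apply/subsetP=> u;
    rewrite !inE => /orP[] ->; rewrite ?orbT.
apply: subset_trans HKE; rewrite -norm_joinEr // -norm_joinEr // genG gen_subG.
have sBC : B \subset B <*> <[w]> by apply: joing_subl.
apply/subsetP=> u; rewrite !inE -!orbA => /or4P[] /eqP->.
- by rewrite (subsetP sBC) // (subsetP sAB).
- by rewrite (subsetP sBC).
- by rewrite (subsetP sBC) // (subsetP sAB).
- by rewrite -cycle_subG joing_subr.
Qed.
End Presentation.

(** * Orders of generators and comparison of cyclic subgroups *)

Lemma double_Nof n : 0 < n -> (Nof n * 2)%N = (2 ^ n)%N.
Proof. by case: n => // n _; rewrite /Nof subSS subn0 expnSr. Qed.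

(** The relations bound the orders of [x] and [y] by [Nof n] and [2]; the order of [H] is the
    product of these bounds, so both are attained. *)
Lemma sdprod_order (gT : finGroupType) n (x y : gT) (H : {group gT}) :
  0 < n -> x ^+ Nof n = 1 -> y ^+ 2 = 1 -> <[x]> ><| <[y]> = H ->
  #|H| = (2 ^ n)%N -> #[x] = Nof n.
Proof.
move=> n0 xN y2 /sdprod_card oH; rewrite -oH -double_Nof // -!orderE => E.
have N0 : 0 < Nof n by rewrite expn_gt0.
have ox : #[x] <= Nof n by rewrite dvdn_leq // order_dvdn xN.
have oy : #[y] <= 2 by rewrite dvdn_leq // order_dvdn y2.
apply/eqP; rewrite eqn_leq ox -(leq_pmul2r (isT : 0 < 2)) -E leq_mul2l oy orbT //.
Qed.

Lemma free_of_orders (gT : finGroupType) (x z : gT) :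
  <[x]> :&: <[z]> = 1 ->
  forall i j, xzpow x z i j = 1 -> #[x] %| i /\ #[z] %| j.
Proof.
move=> tiXZ i j /eqP; rewrite -eq_invg_mul => /eqP E.
have zj1 : z ^+ j = 1.
  by apply/set1gP; rewrite -tiXZ inE mem_cycle andbT -E groupV mem_cycle.
by rewrite !order_dvdn zj1 -(invgK (x ^+ i)) E zj1 invg1.
Qed.

Lemma eq_cycle_expn (gT : finGroupType) (x : gT) d e :
  d %| #[x] -> e %| #[x] -> <[x ^+ d]> = <[x ^+ e]> -> d = e.
Proof.
move=> dx ex /(congr1 (fun A : {set gT} => #|A|)).
rewrite -!orderE !orderXdiv // => E.
have x0 := order_gt0 x.
have d0 : 0 < #[x] %/ d by rewrite divn_gt0 ?(dvdn_leq x0) // (dvdn_gt0 x0).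
by apply/eqP; rewrite -(eqn_pmul2l d0) {2}E !divnK.
Qed.

Lemma sdprod_cyclesP (gT : finGroupType) k (x y : gT) :
  x ^ y = x ^+ k -> <[x]> :&: <[y]> = 1 ->
  <[x]> ><| <[y]> = <<[set x; y]>>.
Proof.
move=> xy tiXY.
have nxy : <[y]> \subset 'N(<[x]>) by rewrite norms_cycle xy mem_cycle.
by rewrite sdprodEY // joing_idl joing_idr.
Qed.

(** * Structure of the two factors when normal forms are independent *)

Section Independent.
Variables (n m r a s b t c : nat) (gT : finGroupType) (x y z w : gT).
Hypothesis rel : rels n m r a s b t c x y z w.
Hypothesis indep : forall i j k l, y ^+ k * x ^+ i = w ^+ l * z ^+ j ->
  [/\ Nof n %| i, Nof m %| j, ~~ odd k & ~~ odd l].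

Lemma indep_trivg k i l j : y ^+ k * x ^+ i = w ^+ l * z ^+ j ->
  [/\ x ^+ i = 1, z ^+ j = 1, y ^+ k = 1 & w ^+ l = 1].
Proof.
case: rel => -[xN y2 zM w2 _] _.
have triv (g : gT) d e : g ^+ d = 1 -> d %| e -> g ^+ e = 1.
  by move=> gd /dvdnP[q ->]; rewrite mulnC expgM gd expg1n.
case/indep=> iN jM; rewrite -!dvdn2 => k2 l2.
by split; [apply: triv xN iN | apply: triv zM jM | apply: triv y2 k2 |
           apply: triv w2 l2].
Qed.

Lemma indep_order_x : #[x] = Nof n.
Proof.
case: rel => -[xN _ _ _ _] _.
apply/eqP; rewrite eqn_dvd order_dvdn xN eqxx /=.
by have [] := @indep #[x] 0 0 0; rewrite // expg_order.
Qed.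

Lemma indep_order_z : #[z] = Nof m.
Proof.
case: rel => -[_ _ zM _ _] _.
apply/eqP; rewrite eqn_dvd order_dvdn zM eqxx /=.
by have [] := @indep 0 #[z] 0 0; rewrite // expg_order.
Qed.

Lemma indep_order_y : #[y] = 2.
Proof.
case: rel => -[_ y2 _ _ _] _; apply: nt_prime_order => //.
by apply/eqP=> y1; have [] := @indep 0 0 1%N 0; rewrite // y1.
Qed.

Lemma indep_order_w : #[w] = 2.
Proof.
case: rel => -[_ _ _ w2 _] _; apply: nt_prime_order => //.
by apply/eqP=> w1; have [] := @indep 0 0 0 1%N; rewrite // w1.
Qed.

Lemma indep_ti_xy : <[x]> :&: <[y]> = 1.
Proof.
apply/trivgP/subsetP=> g /setIP[/cycleP[i ->] /cycleP[k E]].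
(* As [y ^+ k] is its own inverse, [x ^+ i = y ^+ k] becomes [y ^+ k * x ^+ i = 1], the shape
   required by [indep_trivg]. *)
have y2 : y ^+ k * y ^+ k = 1.
  by case: rel => -[_ y2 _ _ _] _; rewrite -expgD addnn -mul2n expgM y2 expg1n.
have [|-> _ _ _] := @indep_trivg k i 0 0; last exact: group1.
by rewrite E y2 !expg0 mulg1.
Qed.

Lemma indep_ti_zw : <[z]> :&: <[w]> = 1.
Proof.
apply/trivgP/subsetP=> g /setIP[/cycleP[j ->] /cycleP[l E]].
have w2 : w ^+ l * w ^+ l = 1.
  by case: rel => -[_ _ _ w2 _] _; rewrite -expgD addnn -mul2n expgM w2 expg1n.
have [|_ -> _ _] := @indep_trivg 0 0 l j; last exact: group1.
by rewrite E w2 !expg0 mulg1.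
Qed.

(** Writing the factors as [<[y]> * <[x]>] and [<[w]> * <[z]>] puts a common element in the two
    forms compared by [indep]. *)
Lemma indep_ti : <<[set x; y]>> :&: <<[set z; w]>> = 1.
Proof.
case: rel => _ [xy zw _ _ _].
have HE : <[y]> * <[x]> = <<[set x; y]>>.
  exact: sdprodWC (sdprod_cyclesP xy indep_ti_xy).
have KE : <[w]> * <[z]> = <<[set z; w]>>.
  exact: sdprodWC (sdprod_cyclesP zw indep_ti_zw).
apply/trivgP/subsetP=> g /=; rewrite -HE -KE => /setIP[].
case/mulsgP=> _ _ /cycleP[k ->] /cycleP[i ->] -> .
case/mulsgP=> _ _ /cycleP[l ->] /cycleP[j ->] /indep_trivg[-> _ -> _].
by rewrite mulg1 group1.
Qed.

End Independent.

Local Close Scope group_scope.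

Theorem theorem6p1 (n m nu mu r a s b t c : nat) (gT : finGroupType)
    (G : {group gT}) (x y z w : gT) :
  3 < n -> 3 < m ->
  nu <= n - 1 -> mu <= m - 1 ->
  r < Nof n -> s < Nof n -> t < Nof n ->
  a < Nof m -> b < Nof m -> c < Nof m ->
  presented_by n m r a s b t c G x y z w ->
  let N := Nof n in let M := Nof m in
  let alpha := alphaof n in let beta := alphaof m in
  let n1 := 2 ^ nu in let m1 := 2 ^ mu in
  let H := <<[set x; y]>>%g in let K := <<[set z; w]>>%g in
  ([/\ (H * K)%g = G, (H :&: K)%g = 1%g,
       (<[x]> ><| <[y]>)%g = H /\ H \isog 'SD_(2 ^ n),
       (<[z]> ><| <[w]>)%g = K /\ K \isog 'SD_(2 ^ m)
     & gcore <[x]>%g G = <[x ^+ n1]>%g /\ gcore <[z]>%g G = <[z ^+ m1]>%g]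
   <->
   [/\ [/\ r * (alpha + 1 + a) = 0 %[mod N], (1 + a) ^ 2 = 1 %[mod M],
           (1 + s) ^ 2 = 1 %[mod N], b * (1 + s + beta) = 0 %[mod M]
         & r * beta = r * (1 + s) %[mod N] (* r(beta - 1 - s) = 0 mod N *)],
       [/\ b * r = 0 %[mod M],
           b * alpha = b * (1 + a) %[mod M] (* b(alpha - 1 - a) = 0 mod M *),
           r * b = 0 %[mod N], t * (2 + s) = 0 %[mod N]
         & c * (1 + beta) + t * b = 0 %[mod M]],
       [/\ t * (1 + alpha) + c * r = 0 %[mod N] & c * (2 + a) = 0 %[mod M]],
       addorder r N = m1
     & addorder b M = n1]).
Proof.
move=> n3 m3 nu_n mu_m _ _ _ _ _ _ [rel genG univ] N M alpha beta n1 m1 H K.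
have n0 : 0 < n by lia.
have m0 : 0 < m by lia.
have N0 : 0 < N by rewrite expn_gt0.
have M0 : 0 < M by rewrite expn_gt0.
have n1N : n1 %| N by apply: dvdn_exp2l.
have m1M : m1 %| M by apply: dvdn_exp2l.
have [[xN y2 zM w2 _] [xy zw _ _ _]] := rel.
split=> [[_ tiHK [defH isoH] [defK isoK] [coreX coreZ]] | ].
  (* Necessity: the semidihedral orders force [x] and [z] to have orders [N] and [M], and the
     trivial intersection makes [<x, z>] free of further relations. *)
  have oH : #|H| = (2 ^ n)%N by rewrite (card_isog isoH) card_semidihedral.
  have oK : #|K| = (2 ^ m)%N by rewrite (card_isog isoK) card_semidihedral.
  have ox : #[x]%g = N by apply: (sdprod_order n0 xN y2 defH).
  have oz : #[z]%g = M by apply: (sdprod_order m0 zM w2 defK).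
  have tiXZ : (<[x]> :&: <[z]> = 1)%g.
    apply/trivgP; rewrite -tiHK setISS // cycle_subG mem_gen // !inE eqxx //.
  have free := free_of_orders tiXZ; rewrite ox oz in free.
  have [c1 c2 c3] := compat_of_free rel free n3 m3.
  have [rM bN] := dvdn_of_free rel free.
  split=> //.
    (* Both exponents divide the order [M] of [z]: [m1] by hypothesis, and [addorder r N] because
       [N %| r * M]. *)
    apply: (@eq_cycle_expn _ z); rewrite ?oz -?addorder_dvdn //.
    by rewrite -coreZ (gcore_z_of_free rel free n3 m3 genG).
  apply: (@eq_cycle_expn _ x); rewrite ?ox -?addorder_dvdn //.
  by rewrite -coreX (gcore_x_of_free rel free n3 m3 genG).
case=> c1 c2 c3 or ob.
(* Sufficiency: conditions (ii) and (iii), with [m1 %| M] and [n1 %| N], give the divisibilities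
   that make the model's matrices well defined. *)
have rM : N %| r * M by rewrite addorder_dvdn // or.
have bN : M %| b * N by rewrite addorder_dvdn // ob.
have [rT [x' [y' [z' [w' [rel' indep']]]]]] :=
  rels_model n3 m3 rM bN (And3 c1 c2 c3).
(* The universal property maps [G] to the model, so an equation between normal forms in [G] also
   holds there, where the exponents can be read off. *)
have [f [fx fy fz fw]] := univ _ _ _ _ _ rel'.
have [xG yG zG wG] : [/\ x \in G, y \in G, z \in G & w \in G].
  by rewrite genG; split; apply: mem_gen; rewrite !inE eqxx ?orbT.
have indep i j k l : (y ^+ k * x ^+ i = w ^+ l * z ^+ j)%g ->
    [/\ N %| i, M %| j, ~~ odd k & ~~ odd l].
  move/(congr1 f); rewrite !morphM ?groupX // !morphX // fx fy fz fw.
  exact: indep'.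
have tiHK : (H :&: K = 1)%g := indep_ti rel indep.
have defH := sdprod_cyclesP xy (indep_ti_xy rel indep).
have defK := sdprod_cyclesP zw (indep_ti_zw rel indep).
have tiXZ : (<[x]> :&: <[z]> = 1)%g.
  apply/trivgP; rewrite -tiHK setISS // cycle_subG mem_gen // !inE eqxx //.
have free := free_of_orders tiXZ.
rewrite (indep_order_x rel indep) (indep_order_z rel indep) in free.
split=> //.
- exact: mulg_of_rels rel _ genG.
- split=> //; apply: semidihedral_isog => //.
  rewrite -(sdprod_card defH) -!orderE (indep_order_x rel indep).
  by rewrite (indep_order_y rel indep) double_Nof.
- split=> //; apply: semidihedral_isog => //.
  rewrite -(sdprod_card defK) -!orderE (indep_order_z rel indep).
  by rewrite (indep_order_w rel indep) double_Nof.
- split; first by rewrite -ob (gcore_x_of_free rel free n3 m3 genG).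
  by rewrite -or (gcore_z_of_free rel free n3 m3 genG).
Qed.
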